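(* Let $M$ be an $R$-module with $|\widehat{A_f(M)}|\geq 3$. Then for $x,y\in\widehat{A_f(M)}$ the following hold. (i) If $M$ is a multiplication module, then $x\sim_{nbd}y$ if and only if $x\sim_M y$. (ii) If $x\sim_{nbd}y$, then $[x:M][y:M]M=0$ if and only if $[x:M]^2M=[y:M]^2M=0$.
   Context: $R$ is a commutative ring with $1\neq 0$ and modules are unitary. For $x\in M$, $[x:M]=\{r\in R : rM\subseteq Rx\}$. An element $x\in M$ is a full-annihilator if either $x=0$ or $[x:M][y:M]M=0$ for some nonzero $y\in M$ with $[y:M]\neq R$; $\widehat{A_f(M)}$ is the set of nonzero full-annihilators of $M$. The full-annihilating graph $ann_f(\Gamma(M))$ is the simple graph with vertex set $\widehat{A_f(M)}$ in which two distinct vertices $x,y$ are adjacent if and only if $[x:M][y:M]M=0$. $N(v)$ denotes the set of all vertices adjacent to $v$. Two distinct vertices $u,v$ are neighbourhood similar, $u\sim_{nbd}v$, if and only if $N(u)=N(v)$ in $ann_f(\Gamma(M))$. Two distinct elements $m_1,m_2\in\widehat{A_f(M)}$ are submodule similar, $m_1\sim_M m_2$, if and only if $ann(m_1)M=ann(m_2)M$, where $ann(m)=\{r\in R: rm=0\}$. A module $M$ is a multiplication module if every submodule of $M$ has the form $IM$ for some ideal $I$ of $R$.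
   Formalization: Neighbourhood similarity of x and y is taken as N(x)\{y} = N(y)\{x} instead of N(x) = N(y); with the latter, part (i) is false: in M = R = Z/25, ann(5)M = ann(10)M but N(5) ≠ N(10), since 5 and 10 are adjacent. *)

(* Defs.v *)
From mathcomp Require Import all_boot all_order all_algebra.
From mathcomp Require Import boolp classical_sets functions cardinality.

Set Implicit Arguments.
Unset Strict Implicit.
Unset Printing Implicit Defensive.
Import GRing.Theory.
Local Open Scope classical_set_scope.
Local Open Scope ring_scope.

Definition submodule (R : comNzRingType) (M : lmodType R) (N : set M) : Prop :=
  submod_closed [in N].

(* R^o is R seen as a module over itself; the improper ideal R is allowed,
   unlike with idealr_closed. *)
Definition ideal (R : comNzRingType) (I : set R) : Prop :=
  @submodule R R^o I.

(* I N: the set of finite sums of products r *: u with r in I and u in N. *)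
Definition smul (R : comNzRingType) (M : lmodType R) (I : set R) (N : set M) :
    set M :=
  [set m | exists n (r : 'I_n -> R) (u : 'I_n -> M),
     [/\ forall i, I (r i), forall i, N (u i) & m = \sum_(i < n) r i *: u i]].

Definition idealM (R : comNzRingType) (I J : set R) : set R :=
  @smul R R^o I J.

Definition multiplication_module (R : comNzRingType) (M : lmodType R) : Prop :=
  forall N : set M, submodule N ->
    exists I : set R, ideal I /\ N = smul I [set: M].

(* [x : M] *)
Definition residual (R : comNzRingType) (M : lmodType R) (x : M) : set R :=
  [set r | range (fun m : M => r *: m) `<=` range (fun s : R => s *: x)].

Definition ann (R : comNzRingType) (M : lmodType R) (x : M) : set R :=
  [set r | r *: x = 0].

(* [x : M] [y : M] M *)
Definition residual_prod (R : comNzRingType) (M : lmodType R) (x y : M) :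
    set M :=
  smul (idealM (residual x) (residual y)) [set: M].

Definition full_annihilator (R : comNzRingType) (M : lmodType R) (x : M) :
    Prop :=
  x = 0 \/
  exists y : M,
    [/\ y <> 0, residual y <> [set: R] & residual_prod x y = [set 0]].

Definition annf_vertices (R : comNzRingType) (M : lmodType R) : set M :=
  [set x | full_annihilator x /\ x <> 0].
Arguments annf_vertices {R} M.

Definition annf_adj (R : comNzRingType) (M : lmodType R) (x y : M) : Prop :=
  [/\ annf_vertices M x, annf_vertices M y, x <> y
    & residual_prod x y = [set 0]].

Definition annf_nbd (R : comNzRingType) (M : lmodType R) (v : M) : set M :=
  [set u | annf_adj v u].

(* u and v have the same neighbours among the vertices other than u and v, the
   usual convention for twin vertices of a simple graph, which allows similar
   vertices to be adjacent. With the unrestricted equality N(u) = N(v),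
   adjacent vertices are never similar, and already for M = R = Z/25 the
   vertices 5 and 10 satisfy ann(5) M = ann(10) M but N(5) <> N(10). *)
Definition nbd_similar (R : comNzRingType) (M : lmodType R) (u v : M) : Prop :=
  annf_nbd u `\ v = annf_nbd v `\ u.

Definition submodule_similar (R : comNzRingType) (M : lmodType R) (u v : M) :
    Prop :=
  smul (ann u) [set: M] = smul (ann v) [set: M].

(* Main.v *)
Require Import Defs.
From mathcomp Require Import all_boot all_order all_algebra.
From mathcomp Require Import boolp classical_sets functions cardinality.
Import GRing.Theory.
Local Open Scope classical_set_scope.
Local Open Scope ring_scope.

(** Write x _|_ y for [x:M][y:M]M = 0. This relation is symmetric, and every
    nonzero element orthogonal to a vertex is a vertex, so neighbourhood
    similarity of x <> y says exactly that an element other than x and y is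
    orthogonal to x iff it is orthogonal to y. What remains is to control
    orthogonality among x and y themselves.

    The lever is to feed the multiples c x into this equivalence. Suppose that
    an orthogonality involving x fails, so that some u <> 0 lies in the
    corresponding submodule [x:M][v:M]M. Since [cx:M] contains c [x:M], every
    scalar c with c x orthogonal to v kills u; hence every c either fixes x or
    kills u. Applying this to c and 1 - c, every c fixes or kills x
    (fix_or_kill): R x = {0, x}.

    - If x _|_ x and y _|_ y but not x _|_ y (orth_of_self), then R x = {0, x}
      and R y = {0, y}, while the nonzero submodule [x:M][y:M]M lies in both,
      so x = y.
    - If x _|_ y but not x _|_ x (orth_self_of_orth), some e in [x:M] fixes x
      and M = Rx (+) N with N the kernel of e. Then x is orthogonal precisely
      to N. A nonzero n in N other than y would be orthogonal to x, hence to y,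
      hence so would x + n be, which would put x + n in N. So N = {0, y}, and a
      third vertex z lies outside N, that is, e z = x. Let w <> 0 be orthogonal
      to z. Since e lies in [z:M], e kills w, so w = y; thus z is orthogonal to
      y, hence to x, although it is not in N.

    In a multiplication module {z | x _|_ z} is the submodule ann(x)M
    (multiplication_orth_ann), so submodule similarity says that x and y are
    orthogonal to the same elements. Neighbourhood similarity gives the same
    once x _|_ x implies x _|_ y, which follows from closure of ann(x)M under
    sums (multiplication_orth_of_self). *)

(** * Orthogonality and vertices *)

Definition orth {R : comNzRingType} {M : lmodType R} (x y : M) : Prop :=
  forall (r s : R) (m : M), residual x r -> residual y s -> r *: (s *: m) = 0.

Lemma residualP {R : comNzRingType} {M : lmodType R} (x : M) (r : R) :
  residual x r <-> forall m : M, exists s : R, r *: m = s *: x.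
Proof.
split=> [xr m | xr _ [m _ <-]].
  by have [s _ <-] := xr _ (ex_intro2 _ _ m I erefl); exists s.
by have [s ->] := xr m; exists s.
Qed.

Lemma residualZ {R : comNzRingType} {M : lmodType R} (x : M) (c r : R) :
  residual x r -> residual (c *: x) (c * r).
Proof.
move=> /residualP xr; apply/residualP => m.
have [s rm] := xr m; exists s.
by rewrite -scalerA rm !scalerA mulrC.
Qed.

Lemma residual_sub {R : comNzRingType} {M : lmodType R} (x : M) (c r : R) :
  residual (c *: x) r -> residual x r.
Proof.
move=> /residualP xr; apply/residualP => m.
by have [s ->] := xr m; exists (s * c); rewrite scalerA.
Qed.

Lemma residual_prodP {R : comNzRingType} {M : lmodType R} (x y : M) :
  residual_prod x y = [set 0] <-> orth x y.
Proof.
split=> [xy0 r s m xr ys | xy].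
  rewrite scalerA; suff : residual_prod x y ((r * s) *: m) by rewrite xy0.
  exists 1, (fun=> r * s), (fun=> m); split=> //; last by rewrite big_ord1.
  move=> _; exists 1, (fun=> r), (fun=> s : R^o); split=> //.
  by rewrite big_ord1.
apply/seteqP; split=> [_ [n [r [u [xyr _ ->]]]] | _ ->] /=; last first.
  exists 0, (fun=> 0), (fun=> 0); split=> //; last by rewrite big_ord0.
  by case.
apply: big1 => i _; have [k [a [b [xa yb ->]]]] := xyr i.
rewrite scaler_suml; apply: big1 => j _.
by rewrite -[a j *: b j]/(a j * b j) -scalerA xy.
Qed.

Lemma orthC {R : comNzRingType} {M : lmodType R} (x y : M) :
  orth x y -> orth y x.
Proof. by move=> xy r s m yr xs; rewrite scalerA mulrC -scalerA xy. Qed.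

Lemma orthZr {R : comNzRingType} {M : lmodType R} (x y : M) (c : R) :
  orth x y -> orth x (c *: y).
Proof. by move=> xy r s m xr /residual_sub; exact: xy. Qed.

(** A neighbour x whose residual is the whole ring cannot witness that z is a
    full-annihilator; in that case [z:M]M = 0 and z is its own witness. *)
Lemma vertex_orth {R : comNzRingType} {M : lmodType R} (x z : M) :
  annf_vertices M x -> z <> 0 -> orth x z -> annf_vertices M z.
Proof.
move=> [_ x0] z0 /orthC zx; split=> //; right.
have [xT | xT] := pselect (residual x = setT); last first.
  by exists x; split=> //; apply/residual_prodP.
exists z; split=> // [zT|].
  by apply: x0; rewrite -[x]scale1r -[x]scale1r zx ?xT ?zT.
apply/residual_prodP => r s m zr _.
by rewrite -[s *: m]scale1r zx ?xT.
Qed.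

(** * Orthogonality between two similar vertices *)

(** One half of neighbourhood similarity, freed from vertices: the arguments
    below use the two directions separately. *)
Definition orth_transfer {R : comNzRingType} {M : lmodType R} (x y : M) :=
  forall z : M, z <> x -> z <> y -> orth x z -> orth y z.

Lemma nbd_similar_transfer {R : comNzRingType} {M : lmodType R} (x y : M) :
  annf_vertices M x -> nbd_similar x y -> orth_transfer x y.
Proof.
move=> Vx xy z zx zy oxz.
have [->|z0] := pselect (z = 0).
  move=> r s m _ /residualP /(_ m)[t ->].
  by rewrite !scaler0.
suff [[_ _ _ /residual_prodP]//] : (annf_nbd y `\ x) z.
rewrite -xy; split=> //; split=> //; first exact: vertex_orth oxz.
  exact/nesym.
exact/residual_prodP.
Qed.

(** If neither c nor 1 - c fixes x, both kill u, hence so does their sum 1. So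
    one of them fixes x, and 1 - c fixes x exactly when c kills it. *)
Lemma fix_or_kill {R : comNzRingType} {M : lmodType R} (x u : M) :
  u <> 0 -> (forall c : R, c *: x = x \/ c *: u = 0) ->
  forall c : R, c *: x = x \/ c *: x = 0.
Proof.
move=> u0 xu c; have [|cu] := xu c; first by left.
right; have [|] := xu (1 - c); rewrite scalerBl scale1r.
  by move/eqP; rewrite subr_eq addrC -subr_eq subrr eq_sym => /eqP.
by rewrite cu subr0.
Qed.

Lemma not_orth {R : comNzRingType} {M : lmodType R} (x y : M) :
  ~ orth x y -> exists (r s : R) (m : M),
    [/\ residual x r, residual y s & r *: (s *: m) <> 0].
Proof.
move=> nxy; apply: contrapT => H; apply: nxy => r s m xr ys.
by apply: contrapT => rsm; apply: H; exists r, s, m.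
Qed.

(** Here u is a nonzero element of [x:M][y:M]M: a multiple of x is orthogonal
    to x, hence, unless it is x, also to y, so that c kills u. *)
Lemma orth_self_fix_or_kill {R : comNzRingType} {M : lmodType R}
    (x y : M) :
  orth_transfer x y -> orth x x -> ~ orth x y ->
  forall c : R, c *: x = x \/ c *: x = 0.
Proof.
move=> Txy xx nxy; have [r [s [m [xr ys rsm]]]] := not_orth _ _ nxy.
apply: fix_or_kill rsm _ => c.
have [|cx] := pselect (c *: x = x); [by left | right].
have [cy|cy] := pselect (c *: x = y).
  by case: nxy; rewrite -cy; exact: orthZr.
have /orthC ycx : orth y (c *: x) by apply: Txy => //; exact: orthZr.
by rewrite scalerA ycx //; exact: residualZ.
Qed.

(** A nonzero element of [x:M][y:M]M is a multiple of both x and y, and each of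
    these has only itself as a nonzero multiple. *)
Lemma orth_of_self {R : comNzRingType} {M : lmodType R} (x y : M) :
  x <> y -> orth_transfer x y -> orth_transfer y x ->
  orth x x -> orth y y -> orth x y.
Proof.
move=> xy Txy Tyx xx yy; apply: contrapT => nxy.
have nyx : ~ orth y x by move/orthC.
have mx := orth_self_fix_or_kill _ _ Txy xx nxy.
have my := orth_self_fix_or_kill _ _ Tyx yy nyx.
have [r [s [m [xr ys]]]] := not_orth _ _ nxy; apply.
have /residualP /(_ (s *: m)) [a ra] := xr.
have /residualP /(_ (r *: m)) [b sb] := ys.
have ab : a *: x = b *: y by rewrite -ra -sb !scalerA mulrC.
have [ax|ax] := mx a; last by rewrite ra.
have [bY|bY] := my b; last by rewrite ra ab.
by case: xy; rewrite -ax ab.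
Qed.

(** A set inside {x, y} is an image of a two-element set. *)
Lemma third_element {T : Type} (A : set T) (x y : T) :
  (`I_3 #<= A)%card -> exists z, [/\ A z, z <> x & z <> y].
Proof.
move=> A3; apply: contrapT => H.
pose g k := if k is 0%N then x else y.
suff Ag : A `<=` g @` `I_2.
  have := card_le_trans A3 (card_le_trans (subset_card_le Ag)
    (card_image_le g `I_2)).
  by rewrite card_le_II.
move=> z Az; have [->|zx] := pselect (z = x); first by exists 0%N.
have [->|zy] := pselect (z = y); first by exists 1%N.
by case: H; exists z.
Qed.

(** As e z lies in Rx = {0, x}, the alternative is e z = x. It makes eM = Rx a
    part of Rz, so that e lies in both residuals and x = e (e x) = 0. *)
Lemma orth_projection0 {R : comNzRingType} {M : lmodType R} (x z : M) (e : R) :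
  (forall c : R, c *: x = x \/ c *: x = 0) ->
  residual x e -> e *: x = x -> orth x z -> e *: z = 0.
Proof.
move=> mx xe ex xz; have /residualP eM := xe; have [c ez] := eM z.
have [cx|cx] := mx c; rewrite ez //.
rewrite cx in ez; rewrite cx -{1}ex -{1}ex.
apply: xz => //; apply/residualP => m.
by have [u ->] := eM m; exists (u * e); rewrite -scalerA ez.
Qed.

(** Rx and Rn both contain [x:M][n:M]M, and they meet only in 0, because e is
    the identity on the first and zero on the second. *)
Lemma projection0_orth {R : comNzRingType} {M : lmodType R} (x n : M) (e : R) :
  e *: x = x -> e *: n = 0 -> orth x n.
Proof.
move=> ex en r s m /residualP xr /residualP ns.
have [t ->] := ns m; have [u rn] := xr n.
have rn0 : r *: n = 0.
  rewrite rn -ex scalerA mulrC -scalerA -rn.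
  by rewrite scalerA mulrC -scalerA en scaler0.
by rewrite scalerA mulrC -scalerA rn0 scaler0.
Qed.

(** A scalar s in [x + n : M] splits as e s + (1 - e) s with e s in [x:M] and
    (1 - e) s in [n:M], since 1 - e sends x + n to n. *)
Lemma orth_split {R : comNzRingType} {M : lmodType R} (x n y : M) (e : R) :
  residual x e -> e *: x = x -> e *: n = 0 ->
  orth y x -> orth y n -> orth y (x + n).
Proof.
move=> xe ex en yx yn r s m yr /residualP xns.
have ns : residual n ((1 - e) * s).
  apply/residualP => m'; have [t sm] := xns m'; exists t.
  rewrite -scalerA sm scalerA mulrC -scalerA.
  by rewrite scalerBl scale1r (scalerDr e) ex en addr0 addrC addKr.
have -> : s *: m = e *: (s *: m) + ((1 - e) * s) *: m.
  by rewrite -scalerA scalerBl scale1r addrC subrK.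
by rewrite scalerDr yx // yn // addr0.
Qed.

(** Failure of the conclusion forces M = Rx (+) {0, y} with Rx = {0, x}, a module
    with four elements whose only vertices are x and y. *)
Lemma orth_self_of_orth {R : comNzRingType} {M : lmodType R} (x y : M) :
  (`I_3 #<= annf_vertices M)%card ->
  x <> y -> orth_transfer x y -> orth_transfer y x ->
  orth x y -> orth x x.
Proof.
move=> M3 xy Txy Tyx oxy; have oyx := orthC _ _ oxy.
apply: contrapT => nxx.
have [r [s [m [xr xs rsm]]]] := not_orth _ _ nxx.
have mx : forall c : R, c *: x = x \/ c *: x = 0.
  apply: fix_or_kill rsm _ => c.
  have [|cx] := pselect (c *: x = x); [by left | right].
  have /orthC xcx : orth x (c *: x).
    have [->//|cy] := pselect (c *: x = y).
    by apply: Tyx => //; exact: orthZr.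
  by rewrite scalerA xcx //; exact: residualZ.
(* r plays the role of the projection e of M onto Rx = {0, x}. *)
have rx : r *: x = x.
  have [//|rx] := mx r; case: rsm.
  have /residualP /(_ m)[t ->] := xs.
  by rewrite scalerA mulrC -scalerA rx scaler0.
have x0 : x <> 0.
  move=> x0; case: nxx => a b k /residualP /(_ (b *: k))[t ->].
  by rewrite x0 scaler0.
have orth0 z : orth x z -> r *: z = 0 by exact: orth_projection0.
have ry : r *: y = 0 by exact: orth0.
(* The kernel N of r has no nonzero element but y. *)
have ker n : r *: n = 0 -> n = 0 \/ n = y.
  move=> rn; have [|n0] := pselect (n = 0); [by left | right].
  apply: contrapT => ny.
  have yn : orth y n.
    apply: Txy => //; last exact: projection0_orth rn.
    by move=> nx; apply: x0; rewrite -rx -nx.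
  suff /orth0 : orth x (x + n) by rewrite scalerDr rx rn addr0.
  apply: Tyx; last exact: (orth_split x n y r).
    move=> xny; apply: x0.
    by rewrite -rx -[x](addrK n) xny scalerBr ry rn subr0.
  by move=> xEn; apply: n0; rewrite -[n](addKr x) xEn addNr.
have [z [[[//|[w [w0 _ /residual_prodP zw]]] z0] zx zy]] :=
  third_element _ x y M3.
have /residualP rM := xr.
have rxy v : r *: v = x -> residual v r.
  move=> rv; apply/residualP => k; have [t ->] := rM k.
  by exists (t * r); rewrite -scalerA rv.
(* A vertex other than x and y lies outside N = {0, y}. *)
have rz : r *: z = x.
  have [t rz] := rM z; have [tx|tx] := mx t; rewrite tx in rz => //.
  by have [|] := ker _ rz.
(* r z = x puts r in [z:M]; r w = x would put r in [w:M] as well. *)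
have rw : r *: w = 0.
  have [t rw] := rM w; have [tx|tx] := mx t; rewrite tx in rw => //.
  by case: x0; rewrite -{1}rx -{1}rx zw //; exact: rxy.
have [//|wy] := ker _ rw.
have /orth0 : orth x z by apply: Tyx => //; apply: orthC; rewrite -wy.
by rewrite rz.
Qed.

(** * Multiplication modules *)

Lemma cyclic_submodule {R : comNzRingType} {M : lmodType R} (x : M) :
  submodule (range (fun s : R => s *: x)).
Proof.
split=> [|a u v]; rewrite !inE.
  by exists 0; rewrite ?scale0r.
move=> [s _ <-] [t _ <-]; exists (a * s + t) => //.
by rewrite scalerDl scalerA.
Qed.

(** The form [x:M]M = Rx of the multiplication property: any ideal I with
    IM = Rx is contained in [x:M]. *)
Lemma multiplication_generator {R : comNzRingType} {M : lmodType R} (x : M) :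
  multiplication_module M -> smul (residual x) [set: M] x.
Proof.
move=> mM; have [I [_ xI]] := mM _ (cyclic_submodule x).
have : smul I [set: M] x by rewrite -xI; exists 1; rewrite ?scale1r.
move=> [n [r [u [Ir _ xE]]]]; exists n, r, u; split=> // i.
move=> _ [m _ <-]; suff : smul I [set: M] (r i *: m) by rewrite -xI.
by exists 1, (fun=> r i), (fun=> m); rewrite big_ord1; split.
Qed.

(** The element z may replace its residual because z lies in [z:M]M = Rz. This
    makes orthogonality to x additive in z, which residuals do not show: in
    general [z + w : M] is not contained in [z:M] + [w:M]. *)
Lemma multiplication_orthE {R : comNzRingType} {M : lmodType R} (x z : M) :
  multiplication_module M ->
  orth x z <-> forall r, residual x r -> r *: z = 0.
Proof.
move=> mM; split=> [xz r xr|xz r s m xr /residualP/(_ m)[t ->]]; last first.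
  by rewrite scalerA mulrC -scalerA xz // scaler0.
have [n [s [u [zs _ ->]]]] := multiplication_generator z mM.
by rewrite scaler_sumr big1 // => i _; exact: xz.
Qed.

(** From left to right, [z:M] kills Rx, so z in [z:M]M lies in ann(x)M. From
    right to left, [x:M] ann(x) M is contained in ann(x) x = 0. *)
Lemma multiplication_orth_ann {R : comNzRingType} {M : lmodType R} (x z : M) :
  multiplication_module M -> orth x z <-> smul (ann x) [set: M] z.
Proof.
move=> mM; split=> [/orthC xz|[n [a [u [xa _ ->]]]]].
  have [n [s [u [zs _ ->]]]] := multiplication_generator z mM.
  exists n, s, u; split=> // i.
  by move/multiplication_orthE: xz; apply.
apply/multiplication_orthE => // r /residualP xr.
rewrite scaler_sumr big1 // => i _; have [t rt] := xr (u i).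
by rewrite scalerA mulrC -scalerA rt scalerA mulrC -scalerA (xa i) scaler0.
Qed.

(** Take w orthogonal to y. If w = y, orth_of_self applies. Otherwise w is
    orthogonal to x too, hence so is x + w, and then both w and x + w, and so
    their difference x, are orthogonal to y. *)
Lemma multiplication_orth_of_self {R : comNzRingType} {M : lmodType R}
    (x y : M) :
  multiplication_module M -> annf_vertices M y ->
  x <> y -> orth_transfer x y -> orth_transfer y x ->
  orth x x -> orth x y.
Proof.
move=> mM [[//|[w [w0 _ /residual_prodP yw]]] _] xy Txy Tyx xx.
have [yy|nyy] := pselect (orth y y); first exact: orth_of_self.
apply: contrapT => nxy.
have wx : w <> x by move=> wx; apply: nxy; apply: orthC; rewrite -wx.
have wy : w <> y by move=> wy; apply: nyy; rewrite -{2}wy.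
have xw : orth x w by exact: Tyx.
have act (a z : M) (r : R) : orth a z -> residual a r -> r *: z = 0.
  by move=> az; have /(_ az) := proj1 (multiplication_orthE a z mM); apply.
have xxw : orth x (x + w).
  apply/multiplication_orthE => // r xr; rewrite scalerDr.
  by rewrite !(act x) // addr0.
have yxw : orth y (x + w).
  apply: Txy => //; last by move=> xwy; apply: nxy; rewrite -xwy.
  by move=> xEw; apply: w0; rewrite -[w](addKr x) xEw addNr.
apply: nxy; apply: orthC; apply/multiplication_orthE => // r yr.
by rewrite -[x](addrK w) scalerBr !(act y) // subr0.
Qed.

Theorem theorem3p6 (R : comNzRingType) (M : lmodType R)
    (card_ge3 : (`I_3 #<= annf_vertices M)%card)
    (x y : M) (Vx : annf_vertices M x) (Vy : annf_vertices M y) :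
  (multiplication_module M -> (nbd_similar x y <-> submodule_similar x y))
  /\
  (nbd_similar x y ->
     (residual_prod x y = [set 0] <->
        residual_prod x x = [set 0] /\ residual_prod y y = [set 0])).
Proof.
have [<-|xy] := pselect (x = y); first by split; [split|move=> _; split=> [|[]]].
have yx : y <> x by exact/nesym.
have transfer : nbd_similar x y -> orth_transfer x y /\ orth_transfer y x.
  by move=> nxy; split; apply: nbd_similar_transfer => //; exact: esym.
split=> [mM|/transfer[Txy Tyx]]; last first.
  split=> [/residual_prodP oxy|[/residual_prodP xx /residual_prodP yy]].
    split; apply/residual_prodP; first exact: orth_self_of_orth oxy.
    exact: orth_self_of_orth (orthC _ _ oxy).
  by apply/residual_prodP; exact: orth_of_self.
split=> [/transfer[Txy Tyx]|sxy].
  have self_iff a b : annf_vertices M b -> a <> b -> orth_transfer a b ->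
      orth_transfer b a -> orth a a <-> orth a b.
    move=> Vb ab Tab Tba; split; last exact: orth_self_of_orth.
    exact: multiplication_orth_of_self.
  have same z : orth x z <-> orth y z.
    have [->|zx] := pselect (z = x).
      have sx := self_iff x y Vy xy Txy Tyx.
      by split=> [/sx /orthC //|/orthC /sx].
    have [->|zy] := pselect (z = y); last by split; [exact: Txy|exact: Tyx].
    have sy := self_iff y x Vx yx Tyx Txy.
    by split=> [/orthC /sy|/sy /orthC].
  by apply/seteqP; split=> z /(multiplication_orth_ann _ _ mM) /same
    /(multiplication_orth_ann _ _ mM).
have same z : orth x z <-> orth y z.
  by rewrite !(multiplication_orth_ann _ _ mM) sxy.
apply/seteqP; split=> z [[_ Vz nz /residual_prodP oz] nz'].
  split; last exact/nesym.
  by split=> //; [exact/nesym | apply/residual_prodP/same].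
split; last exact/nesym.
by split=> //; [exact/nesym | apply/residual_prodP/same].
Qed.
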